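(* (i) Let $\Gamma$ be an additive subgroup of $\mathbb{C}$ containing $1$. Then $$\operatorname{Aut}(\mathcal{W}_\Gamma)=\{\varphi_{a,f}\mid f\in\Gamma^{\vee},\ a\in\mathbb{C}^*\text{ such that } a\Gamma=\Gamma\},$$ where $\varphi_{a,f}$ is the linear map with $\varphi_{a,f}(L_m)=a f(m)L_{m/a}$ for all $m\in\Gamma$. (ii) Let $\Gamma$ be a subgroup of $\mathbb{C}\times\mathbb{Z}_2$. Then $$\operatorname{Aut}(s\mathcal{W}_\Gamma)=\{\varphi_{a,f}\mid f\in\Gamma^{\vee},\ a\in\mathbb{C}^*\text{ such that } a^2\Gamma=\Gamma,\ \operatorname{Re}(a)\ge 0\},$$ where $\varphi_{a,f}$ is the linear map with $\varphi_{a,f}(L_m)=a^2f(m)L_{m/a^2}$ for all $m\in\Gamma_0$ and $\varphi_{a,f}(G_r)=a f(r)G_{r/a^2}$ for all $r\in\Gamma_1$.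
   Context: The base field is $\mathbb{C}$. For an abelian group $\Gamma$, $\Gamma^{\vee}$ is the set of group homomorphisms $\Gamma\to\mathbb{C}^*$. For a subgroup $\Gamma\subset\mathbb{C}$ containing $1$, $\mathcal{W}_\Gamma$ is the Lie algebra with basis $\{L_m\}_{m\in\Gamma}$ and bracket $[L_m,L_n]=(m-n)L_{m+n}$. For a subgroup $\Gamma\subset\mathbb{C}\times\mathbb{Z}_2$, put $\Gamma_0=\{x\in\mathbb{C}\mid (x,0)\in\Gamma\}$ and $\Gamma_1=\{x\in\mathbb{C}\mid(x,1)\in\Gamma\}$. $s\mathcal{W}_\Gamma$ is the Lie superalgebra whose even part has basis $\{L_m\}_{m\in\Gamma_0}$, whose odd part has basis $\{G_r\}_{r\in\Gamma_1}$, with $[L_m,L_n]=(m-n)L_{m+n}$, $[L_m,G_r]=(\tfrac m2-r)G_{m+r}$, $[G_r,G_s]=2L_{r+s}$. For $f\in\Gamma^\vee$, $m\in\Gamma_0$, $r\in\Gamma_1$, one writes $f(m)$ for $f((m,0))$ and $f(r)$ for $f((r,1))$. The condition $a^2\Gamma=\Gamma$ refers to scaling the first coordinate, i.e. $a^2\Gamma_0=\Gamma_0$ and $a^2\Gamma_1=\Gamma_1$. Automorphisms of a Lie superalgebra preserve parity. *)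

(* Defs.v *)
From HB Require Import structures.
From mathcomp Require Import all_boot all_order all_algebra.
From mathcomp Require Import finmap.
From mathcomp Require Import boolp classical_sets.
From mathcomp Require Import monalg.
From mathcomp Require Import ring.

Set Implicit Arguments.
Unset Strict Implicit.
Unset Printing Implicit Defensive.

Import Order.TTheory GRing.Theory Num.Theory.
Local Open Scope classical_set_scope.
Local Open Scope ring_scope.

HB.mixin Record Lmodule_isLieAlgebra (F : numFieldType) V
    of GRing.Lmodule F V := {
  lie : V -> V -> V;
  lieDZl : forall (a : F) (x y z : V),
    lie (a *: x + y) z = a *: lie x z + lie y z;
  lieDZr : forall (a : F) (x y z : V),
    lie z (a *: x + y) = a *: lie z x + lie z y;
  liexx : forall x : V, lie x x = 0;
  lie_jacobi : forall x y z : V,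
    lie x (lie y z) + lie y (lie z x) + lie z (lie x y) = 0
}.

#[short(type="lieAlgType")]
HB.structure Definition LieAlgebra (F : numFieldType) :=
  {V of GRing.Lmodule F V & Lmodule_isLieAlgebra F V}.

(* These axioms define Lie superalgebras because F has characteristic zero. *)
HB.mixin Record Lmodule_isLieSuperalgebra (F : numFieldType) V
    of GRing.Lmodule F V := {
  (* [superpart i] is the set of homogeneous elements of parity [i] *)
  superpart : 'Z_2 -> set V;
  superpart0 : forall i, superpart i 0;
  superpartDZ : forall i (a : F) (x y : V),
    superpart i x -> superpart i y -> superpart i (a *: x + y);
  superpart_sum : forall x : V, exists x0 x1,
    [/\ superpart 0 x0, superpart 1 x1 & x = x0 + x1];
  superpart_cap : forall x : V, superpart 0 x -> superpart 1 x -> x = 0;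
  slie : V -> V -> V;
  slieDZl : forall (a : F) (x y z : V),
    slie (a *: x + y) z = a *: slie x z + slie y z;
  slieDZr : forall (a : F) (x y z : V),
    slie z (a *: x + y) = a *: slie z x + slie z y;
  slie_superpart : forall i j (x y : V),
    superpart i x -> superpart j y -> superpart (i + j) (slie x y);
  slieC : forall i j (x y : V), superpart i x -> superpart j y ->
    slie y x = - ((-1) ^+ (i * j)%N *: slie x y);
  slie_jacobi : forall i j (x y z : V), superpart i x -> superpart j y ->
    slie x (slie y z) =
      slie (slie x y) z + (-1) ^+ (i * j)%N *: slie y (slie x z)
}.

#[short(type="lieSuperalgType")]
HB.structure Definition LieSuperalgebra (F : numFieldType) :=
  {V of GRing.Lmodule F V & Lmodule_isLieSuperalgebra F V}.

Definition lieAut (F : numFieldType) (V : lieAlgType F) : set (V -> V) :=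
  [set phi | [/\ linear phi, bijective phi &
                 forall x y, phi (lie x y) = lie (phi x) (phi y)]].

Definition slieAut (F : numFieldType) (V : lieSuperalgType F) : set (V -> V) :=
  [set phi | [/\ linear phi, bijective phi,
                 forall i x, superpart i x -> superpart i (phi x) &
                 forall x y, phi (slie x y) = slie (phi x) (phi y)]].

Arguments lieAut {F} V.
Arguments slieAut {F} V.

Definition subgroup (V : zmodType) (G : zmodClosed V) := {x : V | x \in G}.
HB.instance Definition _ (V : zmodType) (G : zmodClosed V) :=
  SubChoice.on (subgroup G).
HB.instance Definition _ (V : zmodType) (G : zmodClosed V) :=
  [SubChoice_isSubZmodule of subgroup G by <:].

Lemma subgroupD (V : zmodType) (G : zmodClosed V) (x y : subgroup G) :
  val (x + y) = val x + val y.
Proof. exact: raddfD. Qed.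

(* Group homomorphisms G -> F^*; f 0 = 1 follows from the two conditions. *)
Definition dual (F : fieldType) (G : zmodType) : set (G -> F) :=
  [set f | (forall x, f x != 0) /\ {morph f : x y / x + y >-> x * y}].

Arguments dual F G : clear implicits.

Lemma linear_Z (F : fieldType) (U V : lmodType F) (h : U -> V) : linear h ->
  forall a u, h (a *: u) = a *: h u.
Proof.
move=> lh; have h0 : h 0 = 0.
  by have := lh (-1) 0 0; rewrite scaler0 addr0 scaleN1r addNr.
by move=> a u; have := lh a u 0; rewrite !addr0 h0 addr0.
Qed.

Lemma eq_opp0 (F : numFieldType) (V : lmodType F) (v : V) : v = - v -> v = 0.
Proof.
move/eqP; rewrite -addr_eq0 -mulr2n -scaler_nat scaler_eq0 pnatr_eq0 /=.
by move/eqP.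
Qed.

Lemma linear_add (F : fieldType) (U V : lmodType F) (g h : U -> V) :
  linear g -> linear h -> linear (fun u => g u + h u).
Proof. by move=> lg lh a u v; rewrite lg lh scalerDr addrACA. Qed.

Lemma linear_comp (F : fieldType) (U V W : lmodType F)
    (g : V -> W) (h : U -> V) :
  linear g -> linear h -> linear (fun u => g (h u)).
Proof. by move=> lg lh a u v; rewrite lh lg. Qed.

Lemma linear_cst0 (F : fieldType) (U V : lmodType F) :
  linear (fun _ : U => 0 : V).
Proof. by move=> a u v; rewrite scaler0 addr0. Qed.

Lemma scale3_eq0 (F : fieldType) (V : lmodType F)
    (a a' b b' c c' : F) (x y z v : V) :
  x = a *: (a' *: v) -> y = b *: (b' *: v) -> z = c *: (c' *: v) ->
  a * a' + b * b' + c * c' = 0 -> x + y + z = 0.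
Proof. by move=> -> -> -> e; rewrite !scalerA -!scalerDl e scale0r. Qed.

Lemma scale_eqN (F : fieldType) (V : lmodType F) (a b e : F) (x y v : V) :
  x = a *: v -> y = b *: v -> a = - (e * b) -> x = - (e *: y).
Proof. by move=> -> -> ->; rewrite scaleNr scalerA. Qed.

Lemma scale_eqD (F : fieldType) (V : lmodType F) (a b c e : F) (x y z v : V) :
  x = a *: v -> y = b *: v -> z = c *: v -> a = b + e * c -> x = y + e *: z.
Proof. by move=> -> -> -> ->; rewrite scalerDl scalerA. Qed.

Section LinExt.
Variables (F : fieldType) (K : choiceType).
Implicit Types (V : lmodType F) (x : {malg F[K]}) (k : K).

Definition lin_ext V (h : K -> V) x : V := \sum_(k <- msupp x) x@_k *: h k.

Lemma lin_extEw V (h : K -> V) (d : {fset K}) x :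
  (msupp x `<=` d)%fset -> lin_ext h x = \sum_(k <- d) x@_k *: h k.
Proof.
move=> le_d; rewrite /lin_ext (big_fset_incl _ le_d) // => k _ /mcoeff_outdom ->.
by rewrite scale0r.
Qed.

Lemma lin_ext_linear V (h : K -> V) : linear (lin_ext h).
Proof.
move=> a x y; pose d := (msupp (a *: x + y) `|` (msupp x `|` msupp y))%fset.
rewrite (@lin_extEw _ _ d) ?fsubsetUl //.
rewrite (@lin_extEw _ _ d x); last first.
  exact: fsubset_trans (fsubsetUl _ _) (fsubsetUr _ _).
rewrite (@lin_extEw _ _ d y); last first.
  exact: fsubset_trans (fsubsetUr _ _) (fsubsetUr _ _).
rewrite scaler_sumr -big_split /=; apply: eq_bigr => k _.
by rewrite mcoeffD mcoeffZ scalerDl scalerA.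
Qed.

Lemma lin_extU V (h : K -> V) k : lin_ext h << k >> = h k.
Proof.
by rewrite /lin_ext msuppU oner_eq0 big_seq_fset1 mcoeffUU scale1r.
Qed.

Lemma lin_ext_eq V (f g : {malg F[K]} -> V) x : linear f -> linear g ->
  (forall k, k \in msupp x -> f << k >> = g << k >>) -> f x = g x.
Proof.
move=> lf lg efg.
have sumE (h : {malg F[K]} -> V) : linear h ->
    h x = \sum_(k <- msupp x) x@_k *: h << k >>.
  move=> lh; have hZ := linear_Z lh.
  have h0 : h 0 = 0 by rewrite -(scale0r 0) hZ !scale0r.
  have hD u v : h (u + v) = h u + h v by have := lh 1 u v; rewrite !scale1r.
  rewrite [in LHS](monalgE x) (big_morph h hD h0); apply: eq_bigr => k _.
  rewrite -hZ; congr h; apply/malgP => k'.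
  by rewrite mcoeffZ !mcoeffU mulrnAr mulr1.
rewrite sumE // [RHS]sumE //; apply: eq_big_seq => k kx.
by rewrite efg.
Qed.

Definition bilin_ext V (b : K -> K -> V) x y : V :=
  lin_ext (fun k => lin_ext (b k) y) x.

Lemma bilin_extDl V (b : K -> K -> V) a x y z :
  bilin_ext b (a *: x + y) z = a *: bilin_ext b x z + bilin_ext b y z.
Proof. exact: lin_ext_linear. Qed.

Lemma bilin_extDr V (b : K -> K -> V) a x y z :
  bilin_ext b z (a *: x + y) = a *: bilin_ext b z x + bilin_ext b z y.
Proof.
rewrite /bilin_ext [LHS]/lin_ext.
under eq_bigr do rewrite lin_ext_linear scalerDr scalerA mulrC -scalerA.
by rewrite big_split -scaler_sumr.
Qed.

Lemma bilin_extUU V (b : K -> K -> V) k l :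
  bilin_ext b << k >> << l >> = b k l.
Proof. by rewrite /bilin_ext !lin_extU. Qed.

End LinExt.

(* The basis vector of index v if v \in G, and 0 if not; total, so that the
   index v may be written as an expression in the ambient group V. *)
Definition basis_at (F : fieldType) (V : zmodType) (G : zmodClosed V) (v : V) :
  {malg F[subgroup G]} := if insub v is Some k then << k >> else 0.

Lemma basis_at_val (F : fieldType) (V : zmodType) (G : zmodClosed V)
  (k : subgroup G) : basis_at F G (val k) = << k >>.
Proof. by rewrite /basis_at valK. Qed.

Section Witt.
Variables (F : numFieldType) (Gamma : zmodClosed F).

Definition Witt := {malg F[subgroup Gamma]}.
HB.instance Definition _ := GRing.Lmodule.on Witt.

Definition L (m : F) : Witt := basis_at F Gamma m.

Definition witt_lie : Witt -> Witt -> Witt :=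
  bilin_ext (fun m n => (val m - val n) *: L (val m + val n)).

Lemma LE (k : subgroup Gamma) : L (val k) = << k >>.
Proof. exact: basis_at_val. Qed.

Lemma witt_lieLL (m n : F) : m \in Gamma -> n \in Gamma ->
  witt_lie (L m) (L n) = (m - n) *: L (m + n).
Proof.
move=> mG nG; rewrite -[m](SubK (subgroup Gamma) mG) -[n](SubK (subgroup Gamma) nG).
by rewrite !LE /witt_lie bilin_extUU.
Qed.

Lemma witt_lieU (m n : subgroup Gamma) :
  witt_lie << m >> << n >> = (val m - val n) *: << m + n >>.
Proof. by rewrite /witt_lie bilin_extUU -LE raddfD. Qed.

Lemma witt_lieDl a x y z :
  witt_lie (a *: x + y) z = a *: witt_lie x z + witt_lie y z.
Proof. exact: bilin_extDl. Qed.

Lemma witt_lieDr a x y z :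
  witt_lie z (a *: x + y) = a *: witt_lie z x + witt_lie z y.
Proof. exact: bilin_extDr. Qed.

Lemma witt_lieZr a x y : witt_lie x (a *: y) = a *: witt_lie x y.
Proof. by apply: (@linear_Z _ _ _ (witt_lie x)) => b u v; rewrite witt_lieDr. Qed.

Lemma witt_lieC x y : witt_lie x y = - witt_lie y x.
Proof.
apply: (@lin_ext_eq _ _ _ (witt_lie^~ y) (fun x => - witt_lie y x)).
- by move=> a u v /=; rewrite witt_lieDl.
- by move=> a u v /=; rewrite witt_lieDr opprD scalerN.
move=> m _; apply: (@lin_ext_eq _ _ _ (witt_lie _) (fun y => - witt_lie y _)).
- by move=> a u v /=; rewrite witt_lieDr.
- by move=> a u v /=; rewrite witt_lieDl opprD scalerN.
by move=> n _; rewrite !witt_lieU -scaleNr opprB [n + m]addrC.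
Qed.

Lemma witt_liexx x : witt_lie x x = 0.
Proof. exact: eq_opp0 (witt_lieC x x). Qed.

Lemma witt_lieUUU (m n p : subgroup Gamma) :
  witt_lie << m >> (witt_lie << n >> << p >>) =
  (val n - val p) *: ((val m - (val n + val p)) *: << m + (n + p) >>).
Proof. by rewrite [X in witt_lie _ X]witt_lieU witt_lieZr witt_lieU subgroupD. Qed.

Lemma witt_jacobi x y z :
  witt_lie x (witt_lie y z) + witt_lie y (witt_lie z x)
    + witt_lie z (witt_lie x y) = 0.
Proof.
pose J x y z := witt_lie x (witt_lie y z) + witt_lie y (witt_lie z x)
    + witt_lie z (witt_lie x y).
have Jrot u v w : J u v w = J v w u by rewrite /J [RHS]addrC addrA.
have Jlin v w : linear (fun u => J u v w).
  apply: linear_add; first apply: linear_add.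
  - by move=> a u u'; rewrite witt_lieDl.
  - by move=> a u u'; rewrite witt_lieDr witt_lieDr.
  - by move=> a u u'; rewrite witt_lieDl witt_lieDr.
have lin0 := @linear_cst0 F Witt Witt.
apply: (@lin_ext_eq _ _ _ (fun u => J u y z) (fun=> 0)) => // m _; rewrite Jrot.
apply: (@lin_ext_eq _ _ _ (fun u => J u z << m >>) (fun=> 0)) => // n _; rewrite Jrot.
apply: (@lin_ext_eq _ _ _ (fun u => J u << m >> << n >>) (fun=> 0)) => // p _.
have e2 : n + (p + m) = m + (n + p) by rewrite addrA addrC.
have e3 : p + (m + n) = m + (n + p) by rewrite addrC -addrA.
have h2 := witt_lieUUU n p m; have h3 := witt_lieUUU p m n.
rewrite {}e2 in h2; rewrite {}e3 in h3.
rewrite /J; apply: (scale3_eq0 h3 (witt_lieUUU m n p) h2).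
by move: (val m) (val n) (val p) => a b c; ring.
Qed.

HB.instance Definition _ :=
  Lmodule_isLieAlgebra.Build F Witt
    witt_lieDl witt_lieDr witt_liexx witt_jacobi.

Definition witt_phi (a : F) (f : subgroup Gamma -> F) : Witt -> Witt :=
  lin_ext (fun m => (a * f m) *: L (val m / a)).

Lemma witt_phi_linear a f : linear (witt_phi a f).
Proof. exact: lin_ext_linear. Qed.

Lemma witt_phiL a f (m : subgroup Gamma) :
  witt_phi a f (L (val m)) = (a * f m) *: L (val m / a).
Proof. by rewrite LE /witt_phi lin_extU. Qed.

End Witt.

Section SuperWitt.
Variables (F : numFieldType) (Gamma : zmodClosed (F * 'Z_2)%type).

Definition sWitt := {malg F[subgroup Gamma]}.
HB.instance Definition _ := GRing.Lmodule.on sWitt.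

Definition sL (m : F) : sWitt := basis_at F Gamma (m, 0).
Definition sG (r : F) : sWitt := basis_at F Gamma (r, 1).

Definition switt_part (i : 'Z_2) : set sWitt :=
  [set x | forall k, k \in msupp x -> (val k).2 = i].

(* The bracket of the basis vectors of indices x and y. *)
Definition switt_lie_basis (x y : F * 'Z_2) : sWitt :=
  match x.2 == 0, y.2 == 0 with
  | true, true => (x.1 - y.1) *: sL (x.1 + y.1)
  | true, false => (x.1 / 2 - y.1) *: sG (x.1 + y.1)
  (* [G_r, L_m] = - [L_m, G_r] *)
  | false, true => - ((y.1 / 2 - x.1) *: sG (y.1 + x.1))
  | false, false => 2 *: sL (x.1 + y.1)
  end.

Definition switt_lie : sWitt -> sWitt -> sWitt :=
  bilin_ext (fun x y => switt_lie_basis (val x) (val y)).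

Lemma switt_lie_basis_at (x y : F * 'Z_2) : x \in Gamma -> y \in Gamma ->
  switt_lie (basis_at F Gamma x) (basis_at F Gamma y) = switt_lie_basis x y.
Proof.
move=> xG yG; rewrite -[x](SubK (subgroup Gamma) xG) -[y](SubK (subgroup Gamma) yG).
by rewrite !basis_at_val /switt_lie bilin_extUU.
Qed.

Lemma switt_lieLL (m n : F) : (m, 0) \in Gamma -> (n, 0) \in Gamma ->
  switt_lie (sL m) (sL n) = (m - n) *: sL (m + n).
Proof. exact: switt_lie_basis_at. Qed.

Lemma switt_lieLG (m r : F) : (m, 0) \in Gamma -> (r, 1) \in Gamma ->
  switt_lie (sL m) (sG r) = (m / 2 - r) *: sG (m + r).
Proof. exact: switt_lie_basis_at. Qed.

Lemma switt_lieGG (r s : F) : (r, 1) \in Gamma -> (s, 1) \in Gamma ->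
  switt_lie (sG r) (sG s) = 2 *: sL (r + s).
Proof. exact: switt_lie_basis_at. Qed.

Definition switt_coef (x y : F * 'Z_2) : F :=
  match x.2 == 0, y.2 == 0 with
  | true, true => x.1 - y.1
  | true, false => x.1 / 2 - y.1
  | false, true => x.1 - y.1 / 2
  | false, false => 2
  end.

Lemma Z2P (i : 'Z_2) : i = 0 \/ i = 1.
Proof. by case: i => [[|[|]]] // p; [left | right]; apply: val_inj. Qed.

Lemma switt_lieU (x y : subgroup Gamma) :
  switt_lie << x >> << y >> = switt_coef (val x) (val y) *: << x + y >>.
Proof.
rewrite /switt_lie bilin_extUU -basis_at_val subgroupD.
case: (val x) (val y) => [a i] [b j].
have -> : (a, i) + (b, j) = (a + b, i + j) by [].
have Z11 : 1 + 1 = 0 :> 'Z_2 by apply: val_inj.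
have Z10 : (1 == 0 :> 'Z_2) = false by [].
rewrite /switt_lie_basis /switt_coef /sL /sG [(a, i).1]/= [(a, i).2]/=.
rewrite [(b, j).1]/= [(b, j).2]/=; move: (basis_at F Gamma) => v.
case: (Z2P i) (Z2P j) => -> [] ->; rewrite ?eqxx ?Z10 ?Z11 ?addr0 ?add0r //.
by rewrite -scaleNr opprB [b + a]addrC.
Qed.

Lemma switt_lieDl a x y z :
  switt_lie (a *: x + y) z = a *: switt_lie x z + switt_lie y z.
Proof. exact: bilin_extDl. Qed.

Lemma switt_lieDr a x y z :
  switt_lie z (a *: x + y) = a *: switt_lie z x + switt_lie z y.
Proof. exact: bilin_extDr. Qed.

Lemma switt_lieZl a x y : switt_lie (a *: x) y = a *: switt_lie x y.
Proof. by apply: (@linear_Z _ _ _ (switt_lie^~ y)) => b u v; rewrite switt_lieDl. Qed.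

Lemma switt_lieZr a x y : switt_lie x (a *: y) = a *: switt_lie x y.
Proof. by apply: (@linear_Z _ _ _ (switt_lie x)) => b u v; rewrite switt_lieDr. Qed.

Lemma switt_part0 i : switt_part i 0.
Proof. by move=> k; rewrite msupp0. Qed.

Lemma switt_partDZ i a x y :
  switt_part i x -> switt_part i y -> switt_part i (a *: x + y).
Proof.
move=> xi yi k /(fsubsetP (msuppD_le _ _)); rewrite in_fsetU => /orP[|/yi //].
by move=> /(fsubsetP (msuppZ_le _ _)) /xi.
Qed.

Lemma switt_partU (k : subgroup Gamma) : switt_part (val k).2 << k >>.
Proof. by move=> l /(fsubsetP msuppU_le); rewrite in_fset1 => /eqP ->. Qed.

Lemma switt_part_lin_ext i (h : subgroup Gamma -> sWitt) (x : sWitt) :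
  (forall k, k \in msupp x -> switt_part i (h k)) -> switt_part i (lin_ext h x).
Proof.
move=> hi; rewrite /lin_ext big_seq; elim/big_rec: _ => [|k y kx yi].
  exact: switt_part0.
exact: switt_partDZ (hi k kx) yi.
Qed.

Lemma switt_part_sum x : exists x0 x1,
  [/\ switt_part 0 x0, switt_part 1 x1 & x = x0 + x1].
Proof.
pose h i (k : subgroup Gamma) : sWitt := if (val k).2 == i then << k >> else 0.
have hi i k : switt_part i (h i k).
  rewrite /h; case: eqP => [<-|_]; [exact: switt_partU | exact: switt_part0].
exists (lin_ext (h 0) x), (lin_ext (h 1) x); split.
- by apply: switt_part_lin_ext => k _.
- by apply: switt_part_lin_ext => k _.
apply: (@lin_ext_eq _ _ _ id (fun x => lin_ext (h 0) x + lin_ext (h 1) x)) => //.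
  by apply: linear_add; apply: lin_ext_linear.
move=> k _; rewrite !lin_extU /h.
by case: (Z2P (val k).2) => -> /=; rewrite ?addr0 ?add0r.
Qed.

Lemma switt_part_cap x : switt_part 0 x -> switt_part 1 x -> x = 0.
Proof.
move=> x0 x1; apply/malgP => k; rewrite mcoeff0.
by case: (boolP (k \in msupp x)) => [kx|/mcoeff_outdom //]; have := x0 k kx; rewrite x1.
Qed.

Lemma switt_lie_part i j x y : switt_part i x -> switt_part j y ->
  switt_part (i + j) (switt_lie x y).
Proof.
move=> xi yj; apply: switt_part_lin_ext => k kx.
apply: switt_part_lin_ext => l ly.
rewrite -(xi k kx) -(yj l ly) -(bilin_extUU (fun x y => switt_lie_basis (val x) (val y))).
rewrite -/switt_lie switt_lieU -[_ *: _]addr0; apply: switt_partDZ; last exact: switt_part0.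
rewrite (_ : _ + _ = (val (k + l)).2); last by rewrite subgroupD.
exact: switt_partU.
Qed.

Lemma switt_lieC i j x y : switt_part i x -> switt_part j y ->
  switt_lie y x = - ((-1) ^+ (i * j)%N *: switt_lie x y).
Proof.
move=> xi yj; set e := _ ^+ _.
apply: (@lin_ext_eq _ _ _ (switt_lie y) (fun x => - (e *: switt_lie x y))).
- by move=> a u v; rewrite switt_lieDr.
- by move=> a u v; rewrite switt_lieDl scalerDr opprD !scalerA mulrC -scalerA scalerN.
move=> k /xi ki.
apply: (@lin_ext_eq _ _ _ (switt_lie^~ _) (fun y => - (e *: switt_lie _ y))).
- by move=> a u v /=; rewrite switt_lieDl.
- by move=> a u v; rewrite switt_lieDr scalerDr opprD !scalerA mulrC -scalerA scalerN.
move=> l /yj lj /=.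
have eC : l + k = k + l by rewrite addrC.
have h := switt_lieU l k; rewrite {}eC in h.
apply: (scale_eqN h (switt_lieU k l)).
rewrite /e /switt_coef ki lj; move: (val k).1 (val l).1 => a b.
by case: (Z2P i) (Z2P j) => -> [] -> /=; ring.
Qed.

Lemma switt_lieUUr (x y z : subgroup Gamma) :
  switt_lie << x >> (switt_lie << y >> << z >>) =
  (switt_coef (val y) (val z) * switt_coef (val x) (val y + val z))
    *: << x + (y + z) >>.
Proof.
rewrite [X in switt_lie _ X]switt_lieU switt_lieZr switt_lieU subgroupD.
by rewrite scalerA.
Qed.

Lemma switt_lieUUl (x y z : subgroup Gamma) :
  switt_lie (switt_lie << x >> << y >>) << z >> =
  (switt_coef (val x) (val y) * switt_coef (val x + val y) (val z))
    *: << x + (y + z) >>.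
Proof.
rewrite [X in switt_lie X _]switt_lieU switt_lieZl switt_lieU subgroupD.
by rewrite scalerA [x + (y + z)]addrA.
Qed.

Lemma switt_jacobi i j x y z : switt_part i x -> switt_part j y ->
  switt_lie x (switt_lie y z) =
    switt_lie (switt_lie x y) z + (-1) ^+ (i * j)%N *: switt_lie y (switt_lie x z).
Proof.
move=> xi yj; set e := _ ^+ _.
have lr u : linear (switt_lie u) by move=> a v w; rewrite switt_lieDr.
have linZ (h : sWitt -> sWitt) : linear h -> linear (fun u => e *: h u).
  by move=> lh a u v; rewrite lh scalerDr !scalerA mulrC.
apply: (@lin_ext_eq _ _ _ (fun x => switt_lie x (switt_lie y z))
  (fun x => switt_lie (switt_lie x y) z + e *: switt_lie y (switt_lie x z))).
- by move=> a u v; rewrite switt_lieDl.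
- apply: linear_add; first by move=> a u v; rewrite !switt_lieDl.
  by apply: linZ => a u v; rewrite switt_lieDl switt_lieDr.
move=> k /xi ki.
apply: (@lin_ext_eq _ _ _ (fun y => switt_lie << k >> (switt_lie y z))
  (fun y => switt_lie (switt_lie << k >> y) z
            + e *: switt_lie y (switt_lie << k >> z))).
- by move=> a u v; rewrite switt_lieDl switt_lieDr.
- apply: linear_add; first by move=> a u v; rewrite switt_lieDr switt_lieDl.
  by apply: linZ => a u v; rewrite switt_lieDl.
move=> l /yj lj.
apply: (@lin_ext_eq _ _ _ (fun z => switt_lie << k >> (switt_lie << l >> z))
  (fun z => switt_lie (switt_lie << k >> << l >>) z
            + e *: switt_lie << l >> (switt_lie << k >> z))).
- exact: linear_comp (lr _) (lr _).
- apply: linear_add; first by move=> a u v; rewrite switt_lieDr.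
  by apply: linZ; exact: linear_comp (lr _) (lr _).
move=> p _ /=.
have eC : l + (k + p) = k + (l + p) by rewrite addrCA.
have h := switt_lieUUr l k p; rewrite {}eC in h.
apply: (scale_eqD (switt_lieUUr k l p) (switt_lieUUl k l p) h).
move: ki lj; rewrite /e.
case: (val k) (val l) (val p) => [a i'] [b j'] [c q] /= -> -> {h}.
rewrite /switt_coef /=.
by case: (Z2P i) (Z2P j) (Z2P q) => -> [] -> [] -> /=; field.
Qed.

HB.instance Definition _ :=
  Lmodule_isLieSuperalgebra.Build F sWitt
    switt_part0 switt_partDZ switt_part_sum switt_part_cap
    switt_lieDl switt_lieDr switt_lie_part switt_lieC switt_jacobi.

Definition switt_phi (a : F) (f : subgroup Gamma -> F) : sWitt -> sWitt :=
  lin_ext (fun x : subgroup Gamma =>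
    if (val x).2 == 0 then (a ^+ 2 * f x) *: sL ((val x).1 / a ^+ 2)
    else (a * f x) *: sG ((val x).1 / a ^+ 2)).

Lemma switt_phi_linear a f : linear (switt_phi a f).
Proof. exact: lin_ext_linear. Qed.

Lemma switt_phiL a f m (mG : (m, 0) \in Gamma) :
  switt_phi a f (sL m) = (a ^+ 2 * f (Sub (m, 0) mG)) *: sL (m / a ^+ 2).
Proof.
rewrite {1}/sL -[X in basis_at F Gamma X](SubK (subgroup Gamma) mG).
by rewrite basis_at_val /switt_phi lin_extU.
Qed.

Lemma switt_phiG a f r (rG : (r, 1) \in Gamma) :
  switt_phi a f (sG r) = (a * f (Sub (r, 1) rG)) *: sG (r / a ^+ 2).
Proof.
rewrite {1}/sG -[X in basis_at F Gamma X](SubK (subgroup Gamma) rG).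
by rewrite basis_at_val /switt_phi lin_extU.
Qed.

Definition fiber (i : 'Z_2) : set F := [set x | (x, i) \in Gamma].

End SuperWitt.

(* Main.v *)
Require Import Defs.
From mathcomp Require Import all_boot all_order all_algebra finmap.
From mathcomp Require Import boolp classical_sets reals complex monalg.
From mathcomp Require Import ring lra.

Set Implicit Arguments.
Unset Strict Implicit.
Unset Printing Implicit Defensive.

Import Order.TTheory GRing.Theory Num.Theory.
Local Open Scope classical_set_scope.
Local Open Scope ring_scope.

(** The idea is that [L_0] is recognized, up to a scalar, by its adjoint action.

    Both algebras are instances of one construction: a space with a basis
    indexed by an abelian group [K], a bracket sending the basis vectors of
    indices [k] and [l] to a multiple [c k l] of the one of index [k + l], and
    a weight [w : K -> F] together with a parity [e] that separate the indices.
    The vector of index [0] acts diagonally, with eigenvalue [- w k] on the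
    vector of index [k].

    Let [phi] be an automorphism and [x] the image of the vector of index [0].
    The images of the basis vectors are eigenvectors of [ad x]. Order the
    weights compatibly with addition (over the complex numbers, by the
    lexicographic order on real and imaginary parts), and suppose that the
    leading index [m] of [x] has positive weight. An eigenvector with leading
    index [p] above [m] is impossible: its bracket with [x] would have the
    leading index [m + p], above [p], because [c m p] can only vanish when
    [w p] is [w m] or half of it. Since [phi] is onto, though, the index
    [m + m] must occur in one of these eigenvectors
    ([auto0_weight_le]). The reverse order excludes negative weights, so [x] is
    a multiple [a] of the vector of index [0] ([auto0]), and comparing
    eigenvalues shows that [phi] permutes the basis lines, dividing weights by
    [a] ([auto_monomial]). Conversely, every such monomial map whose
    coefficients satisfy the evident cocycle identity is an automorphism
    ([monomial_auto]).

    What is left is to see that the normalized coefficients [f] form a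
    character. The bracket gives [f (k + l) = f k * f l] only where [c k l] is
    nonzero. The exceptional pairs are reached by going through other multiples
    of the same element: [f (2 k)] is compared with [f k ^ 2] through [f (4 k)]
    ([morph_double]), and a similar detour treats the pairs of an even element
    [2 r] and an odd element [r] ([switt_morph]). In the super case the scalar
    of [phi] on [L_0] is only a square [a ^ 2]; the sign of [a] is absorbed in
    [f] on the odd part, which is why [a] can be taken with nonnegative real
    part. *)

(** * Linear maps on a space with a basis *)

Section FreeModule.
Variables (F : numFieldType) (K : choiceType).
Implicit Types (x y : {malg F[K]}) (k l : K).

Lemma linear0E (V W : lmodType F) (h : V -> W) : linear h -> h 0 = 0.
Proof. by move=> lh; rewrite -(scale0r 0) (linear_Z lh) scale0r. Qed.

Lemma bilinear_eq (V : lmodType F) (f g : {malg F[K]} -> {malg F[K]} -> V) :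
  (forall y, linear (f^~ y)) -> (forall x, linear (f x)) ->
  (forall y, linear (g^~ y)) -> (forall x, linear (g x)) ->
  (forall k l, f << k >> << l >> = g << k >> << l >>) ->
  forall x y, f x y = g x y.
Proof.
move=> fl fr gl gr fg x y; apply: (lin_ext_eq (fl y) (gl y)) => k _.
by apply: (lin_ext_eq (fr _) (gr _)) => l _.
Qed.

Lemma coef_linear (phi : {malg F[K]} -> {malg F[K]}) (q : K) :
  linear phi -> linear (fun x => (phi x)@_q : F^o).
Proof. by move=> lphi a x y /=; rewrite lphi mcoeffD mcoeffZ. Qed.

(** Otherwise the coefficient at [q] of [phi] would vanish on the basis, hence
    everywhere. *)
Lemma supp_cover (phi : {malg F[K]} -> {malg F[K]}) (q : K) :
  linear phi -> (exists x, phi x = << q >>) ->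
  exists k, q \in msupp (phi << k >>).
Proof.
move=> lphi [x xq]; apply: contrapT => nq.
have: (phi x)@_q = 0.
  apply: (@lin_ext_eq F K F^o (fun x => (phi x)@_q) (fun=> 0)).
  - exact: coef_linear.
  - exact: linear_cst0.
  by move=> k _; apply/mcoeff_outdom/negP => kq; apply: nq; exists k.
by move/eqP; rewrite xq mcoeffUU oner_eq0.
Qed.

Lemma lin_ext_coef (h : K -> {malg F[K]}) x q :
  (lin_ext h x)@_q = \sum_(k <- msupp x) x@_k * (h k)@_q.
Proof.
rewrite /lin_ext (big_morph _ (mcoeffD q) (mcoeff0 q)).
by apply: eq_bigr => k _; rewrite mcoeffZ.
Qed.

Lemma supp_le1 x k : (forall l, l \in msupp x -> l = k) -> x = x@_k *: << k >>.
Proof.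
move=> xk; apply/malgP => l; rewrite mcoeffZ mcoeffU.
case: (eqVneq k l) => [-> | ne_kl]; first by rewrite mulr1.
rewrite mulr0n mulr0; apply/mcoeff_outdom/negP => /xk lk.
by rewrite lk eqxx in ne_kl.
Qed.

End FreeModule.

(** * Compatible total orders *)

Section PositiveCone.
Variable F : numFieldType.

(** The positive elements of a total order compatible with addition. A
    predicate serves better than an order structure here, because [F] already
    carries a partial order and because both the order and its reverse are used. *)
Definition total_cone (P : pred F) :=
  [/\ forall x y, P x -> P y -> P (x + y), ~~ P 0 &
      forall x, x != 0 -> P x || P (- x)].

Lemma total_coneN P : total_cone P -> total_cone (fun x => P (- x)).
Proof.
case=> PD P0 PV; split; last by move=> x nx; rewrite opprK orbC PV.
  by move=> x y Px Py; rewrite opprD PD.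
by rewrite oppr0.
Qed.

Lemma cone_max (P : pred F) (T : eqType) (w : T -> F) (s : seq T) (t : T) :
  total_cone P -> t \in s ->
  exists2 m, m \in s & forall k, k \in s -> w k = w m \/ P (w m - w k).
Proof.
case=> PD P0 PV; elim: s t => // u s IHs t _.
case: s IHs => [_|v s /(_ v (mem_head _ _)) [m ms mmax]].
  by exists u; rewrite ?mem_head // => k; rewrite inE => /eqP ->; left.
case: (eqVneq (w u) (w m)) => [wum|neq_um].
  exists m; first by rewrite inE ms orbT.
  by move=> k; rewrite inE => /orP[/eqP ->|/mmax //]; left.
have /PV/orP[Pum|] : w u - w m != 0 by rewrite subr_eq0.
  exists u; first exact: mem_head.
  move=> k; rewrite inE => /orP[/eqP ->|/mmax[->|Pmk]]; [by left|by right|right].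
  by rewrite -(subrKA (w m)); apply: PD.
rewrite opprB => Pmu; exists m; first by rewrite inE ms orbT.
by move=> k; rewrite inE => /orP[/eqP ->|/mmax //]; right.
Qed.

End PositiveCone.

(** * Automorphisms of graded brackets *)

Section Graded.
Variables (F : numFieldType) (K E : zmodType).
Variables (w : K -> F) (e : K -> E) (c : K -> K -> F).

Local Notation V := {malg F[K]}.

Definition graded_lie : V -> V -> V := bilin_ext (fun k l => c k l *: << k + l >>).

Definition pure (i : E) (x : V) := forall k, k \in msupp x -> e k = i.

Definition graded_auto (phi : V -> V) :=
  [/\ linear phi, bijective phi, forall i x, pure i x -> pure i (phi x) &
      forall x y, phi (graded_lie x y) = graded_lie (phi x) (phi y)].

Lemma graded_lieUU k l : graded_lie << k >> << l >> = c k l *: << k + l >>.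
Proof. exact: bilin_extUU. Qed.

Lemma graded_lieDl a x y z :
  graded_lie (a *: x + y) z = a *: graded_lie x z + graded_lie y z.
Proof. exact: bilin_extDl. Qed.

Lemma graded_lieDr a x y z :
  graded_lie z (a *: x + y) = a *: graded_lie z x + graded_lie z y.
Proof. exact: bilin_extDr. Qed.

Lemma graded_lieZl a x y : graded_lie (a *: x) y = a *: graded_lie x y.
Proof.
by apply: (@linear_Z _ _ _ (graded_lie^~ y)) => b u v; rewrite graded_lieDl.
Qed.

Lemma graded_lieZr a x y : graded_lie x (a *: y) = a *: graded_lie x y.
Proof.
by apply: (@linear_Z _ _ _ (graded_lie x)) => b u v; rewrite graded_lieDr.
Qed.

(** When [m + p] can be reached in one way only, in particular for leading
    indices, no cancellation is possible. *)
Lemma graded_lie_coef x y m p : m \in msupp x -> p \in msupp y ->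
  (forall k l, k \in msupp x -> l \in msupp y -> k + l = m + p -> k = m) ->
  (graded_lie x y)@_(m + p) = x@_m * y@_p * c m p.
Proof.
move=> mx py top; rewrite lin_ext_coef (big_fsetD1 m mx) /=.
rewrite [X in _ + X]big_seq big1 ?addr0 => [|k].
  rewrite lin_ext_coef (big_fsetD1 p py) /= [X in _ + X]big_seq big1 ?addr0.
    by rewrite mcoeffZ mcoeffUU mulr1 mulrA.
  move=> l; rewrite !inE => /andP[nlp _].
  by rewrite mcoeffZ mcoeffU (inj_eq (addrI m)) (negPf nlp) !mulr0.
rewrite !inE => /andP[nkm kx]; rewrite lin_ext_coef big_seq big1 ?mulr0 // => l ly.
rewrite mcoeffZ mcoeffU; case: eqP => [/(top _ _ kx ly) km|_]; last by rewrite !mulr0.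
by rewrite km eqxx in nkm.
Qed.

Hypothesis wD : {morph w : k l / k + l}.
Hypothesis eD : {morph e : k l / k + l}.
Hypothesis weI : forall k l, w k = w l -> e k = e l -> k = l.
Hypothesis c0 : forall k, c 0 k = - w k.

Let w0 : w 0 = 0.
Proof. by apply: (@addrI _ (w 0)); rewrite -wD !addr0. Qed.

Let e0 : e 0 = 0.
Proof. by apply: (@addrI _ (e 0)); rewrite -eD !addr0. Qed.

Lemma graded_lie0_coef y k : (graded_lie << 0 >> y)@_k = - w k * y@_k.
Proof.
apply: (@lin_ext_eq F K F^o (fun y => (graded_lie << 0 >> y)@_k)
  (fun y => - w k * y@_k)).
- by apply: coef_linear => a u v; rewrite graded_lieDr.
- move=> a u v; rewrite mcoeffD mcoeffZ mulrDr; congr (_ + _).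
  exact: mulrCA.
move=> l _; rewrite graded_lieUU c0 mcoeffZ add0r mcoeffU.
by case: eqP => [->|_]; rewrite ?mulr0.
Qed.

(** Weight and parity determine an index, so the index map of a monomial
    automorphism inherits additivity from them. *)
Lemma scaling_morph (a : F) (psi : K -> K) : a != 0 ->
  (forall k, w k = a * w (psi k)) -> (forall k, e (psi k) = e k) ->
  {morph psi : k l / k + l}.
Proof.
move=> a0 wpsi epsi k l; apply: weI; last by rewrite epsi !eD !epsi.
by apply: (mulfI a0); rewrite -wpsi !wD mulrDr -!wpsi.
Qed.

Lemma scaling_inj (a : F) (psi : K -> K) :
  (forall k, w k = a * w (psi k)) -> (forall k, e (psi k) = e k) ->
  injective psi.
Proof.
move=> wpsi epsi k l kl; apply: weI.
  by rewrite (wpsi k) (wpsi l) kl.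
by rewrite -(epsi k) -(epsi l) kl.
Qed.

(* The case of [w l] equal to half of [w k] is that of an odd [l] in the super
   Witt algebra. *)
Hypothesis c_eq0 : forall k l, e k = 0 -> c k l = 0 ->
  w l = w k \/ w l + w l = w k.

Section Automorphism.
Variable phi : V -> V.
Hypothesis phi_auto : graded_auto phi.

Let phiL : linear phi. Proof. by case: phi_auto. Qed.

Let phi_pure i x : pure i x -> pure i (phi x).
Proof. by case: phi_auto => _ _ + _; apply. Qed.

Let phi_onto y : exists x, phi x = y.
Proof. by case: phi_auto => _ [psi _ K'] _ _; exists (psi y). Qed.

Let phiU_neq0 k : phi << k >> != 0.
Proof.
case: phi_auto => _ /bij_inj phiI _ _; apply/eqP => phik.
have /phiI/eqP : phi << k >> = phi 0 by rewrite phik (linear0E phiL).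
by rewrite monalgU_eq0 oner_eq0.
Qed.

Lemma pureU k : pure (e k) << k >>.
Proof. by move=> l; rewrite msuppU oner_eq0 inE => /eqP ->. Qed.

Let adjoint_eigen k :
  graded_lie (phi << 0 >>) (phi << k >>) = - w k *: phi << k >>.
Proof.
case: phi_auto => _ _ _ <-.
by rewrite graded_lieUU c0 add0r (linear_Z phiL).
Qed.

(** With [m] the leading index of [phi << 0 >>], surjectivity makes [m + m]
    occur in the image [y] of some basis vector, an eigenvector of the adjoint
    action of [phi << 0 >>]. The leading index [p] of [y] is then above [m], and
    the coefficient of the bracket at [m + p], an index above the support of
    [y], has to vanish although [c m p] does not. *)
Lemma auto0_weight_le (P : pred F) i : total_cone P ->
  i \in msupp (phi << 0 >>) -> ~ P (w i).
Proof.
move=> coneP; have [PD P0 PV] := coneP.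
set x := phi << 0 >> => ix Pi.
have ex : pure 0 x by rewrite -e0; apply/phi_pure/pureU.
have [m mx mmax] := cone_max w coneP ix.
have {Pi ix} Pm : P (w m).
  by have [<- //|/PD/(_ Pi)] := mmax _ ix; rewrite subrK.
(* Any index above [m] would do: it has to exceed the weights [w m] and
   [w m / 2] at which [c m] may vanish. *)
have [k qk] := @supp_cover _ _ phi (m + m) phiL (phi_onto _).
set y := phi << k >> in qk; have ey : pure (e k) y by apply/phi_pure/pureU.
have [p py pmax] := cone_max w coneP qk.
have Ppm : P (w p - w m).
  have [|] := pmax _ qk; rewrite wD; first by move=> <-; rewrite addrK.
  by move/PD/(_ Pm); rewrite opprD addrA subrK.
have top j l : j \in msupp x -> l \in msupp y -> j + l = m + p -> j = m.
  move=> jx ly jl; apply: weI; last by rewrite !ex.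
  have [//|Pmj] := mmax _ jx; have wjl : w j + w l = w m + w p by rewrite -!wD jl.
  have [wlp|/(PD _ _ Pmj)] := pmax _ ly; first by apply: (addIr (w l)); rewrite wjl wlp.
  by rewrite addrACA -opprD wjl subrr (negPf P0).
have nmp : y@_(m + p) = 0.
  apply/mcoeff_outdom/negP => /pmax; rewrite wD => -[/eqP|].
    by rewrite -subr_eq0 addrK => /eqP wm0; rewrite wm0 (negPf P0) in Pm.
  by move=> /PD/(_ Pm); rewrite opprD addrCA subrr addr0 addNr (negPf P0).
have := graded_lie_coef mx py top.
rewrite adjoint_eigen mcoeffZ nmp mulr0 => /esym/eqP.
rewrite !mulf_eq0 !mcoeff_eq0 mx py /= => /eqP/(c_eq0 (ex _ mx)) [] wpm.
  by rewrite wpm subrr (negPf P0) in Ppm.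
have: P ((w p - w m) + (w p - w m) + w m) by apply: (PD) => //; apply: PD.
by rewrite addrACA wpm addrA subrr sub0r addNr (negPf P0).
Qed.

Hypothesis ex_cone : exists P : pred F, total_cone P.

(** Weights of the support are neither positive nor, by the reverse order,
    negative; parity then leaves only the index [0]. *)
Lemma auto0 : exists2 a, a != 0 & phi << 0 >> = a *: << 0 >>.
Proof.
have [P coneP] := ex_cone; have [_ _ PV] := coneP.
have x0 : phi << 0 >> = (phi << 0 >>)@_0 *: << 0 >>.
  apply: supp_le1 => k kx; apply: weI; last exact: (phi_pure (@pureU 0)).
  rewrite w0; apply/eqP/negPn/negP => /PV/orP[].
    exact: auto0_weight_le.
  exact: (auto0_weight_le (total_coneN coneP)).
exists (phi << 0 >>)@_0 => //.
by apply/eqP => a0; have := phiU_neq0 0; rewrite x0 a0 scale0r eqxx.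
Qed.

(** [phi << k >>] is an eigenvector, for [- w k], of the adjoint action of
    [a *: << 0 >>], so that all its indices have weight [w k / a] and the parity
    of [k]: there is only one. *)
Lemma auto_monomial : exists a g psi,
  [/\ a != 0, g 0 = a, forall k, g k != 0 &
      forall k, phi << k >> = g k *: << psi k >>] /\
  [/\ forall k, w k = a * w (psi k), forall k, e (psi k) = e k,
      forall l, exists k, psi k = l &
      forall k l, c k l * g (k + l) = g k * g l * c (psi k) (psi l)].
Proof.
have [a a0 phi0] := auto0.
have wsupp k l : l \in msupp (phi << k >>) -> w k = a * w l.
  move=> lk; have := congr1 (mcoeff l) (adjoint_eigen k).
  rewrite phi0 graded_lieZl !mcoeffZ graded_lie0_coef mulrA.
  by rewrite mulrN => /mulIf; rewrite mcoeff_neq0 => /(_ lk) /oppr_inj.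
have esupp k l : l \in msupp (phi << k >>) -> e l = e k.
  by apply: phi_pure; apply: pureU.
have /choice[psi psiP] : forall k, exists l, l \in msupp (phi << k >>).
  move=> k; apply: contrapT => nk; case/eqP: (phiU_neq0 k); apply/malgP => l.
  by rewrite mcoeff0; apply/mcoeff_outdom/negP => lk; apply: nk; exists l.
have wpsi k : w k = a * w (psi k) by apply: wsupp.
have epsi k : e (psi k) = e k by apply: esupp.
have supp1 k l : l \in msupp (phi << k >>) -> l = psi k.
  move=> lk; apply: weI; last by rewrite epsi; apply: esupp.
  by apply: (mulfI a0); rewrite -wpsi -(wsupp _ _ lk).
pose g k := (phi << k >>)@_(psi k).
have phiE k : phi << k >> = g k *: << psi k >> by apply/supp_le1/supp1.
exists a, g, psi; split; split=> //.
- have psi0 : psi 0 = 0.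
    by apply: weI; rewrite ?epsi // w0; apply: (mulfI a0); rewrite mulr0 -wpsi.
  by rewrite /g psi0 phi0 mcoeffZ mcoeffUU mulr1.
- by move=> k; rewrite mcoeff_neq0.
- move=> q; have [k qk] := @supp_cover _ _ phi q phiL (phi_onto _).
  by exists k; rewrite -(supp1 _ _ qk).
move=> k l; have [_ _ _ /(_ << k >> << l >>)] := phi_auto.
rewrite graded_lieUU (linear_Z phiL) !phiE graded_lieZl graded_lieZr graded_lieUU.
rewrite (scaling_morph a0 wpsi epsi) !scalerA.
by move/(congr1 (mcoeff (psi k + psi l))); rewrite !mcoeffZ mcoeffUU !mulr1.
Qed.

End Automorphism.

(** The inverse is the monomial map attached to the inverse index map. *)
Lemma monomial_auto (phi : V -> V) (a : F) (g : K -> F) (psi : K -> K) :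
  linear phi -> a != 0 -> (forall k, g k != 0) ->
  (forall k, phi << k >> = g k *: << psi k >>) ->
  (forall k, w k = a * w (psi k)) -> (forall k, e (psi k) = e k) ->
  (forall l, exists k, psi k = l) ->
  (forall k l, c k l * g (k + l) = g k * g l * c (psi k) (psi l)) ->
  graded_auto phi.
Proof.
move=> phiL a0 g0 phiE wpsi epsi /choice[psi' psi'K] gc.
have psiK k : psi' (psi k) = k by apply: (scaling_inj wpsi epsi); rewrite psi'K.
pose phi' := lin_ext (fun l => (g (psi' l))^-1 *: << psi' l >>) : V -> V.
have phi'L : linear phi' by apply: lin_ext_linear.
split=> //.
- exists phi' => x.
    apply: (@lin_ext_eq _ _ _ (fun x => phi' (phi x)) id) => [||k _] //.
      exact: linear_comp.
    rewrite phiE (linear_Z phi'L) /phi' lin_extU psiK scalerA divff ?scale1r //.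
  apply: (@lin_ext_eq _ _ _ (fun x => phi (phi' x)) id) => [||k _] //.
    exact: linear_comp.
  by rewrite /phi' lin_extU (linear_Z phiL) phiE psi'K scalerA mulVf ?scale1r.
- move=> i x xi q qx; apply: contrapT => qi.
  have: (phi x)@_q = 0.
    apply: (@lin_ext_eq F K F^o (fun x => (phi x)@_q) (fun=> 0)).
    - exact: coef_linear.
    - exact: linear_cst0.
    move=> k /xi ki; rewrite phiE mcoeffZ mcoeffU.
    by case: eqP => [kq|_]; [case: qi; rewrite -kq epsi | rewrite mulr0].
  by move/eqP; rewrite mcoeff_eq0 qx.
apply: (bilinear_eq (f := fun x y => phi (graded_lie x y))
                    (g := fun x y => graded_lie (phi x) (phi y))).
- by move=> y b u v; rewrite graded_lieDl phiL.
- by move=> x b u v; rewrite graded_lieDr phiL.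
- by move=> y b u v; rewrite phiL graded_lieDl.
- by move=> x b u v; rewrite phiL graded_lieDr.
move=> k l; rewrite graded_lieUU (linear_Z phiL) !phiE graded_lieZl graded_lieZr.
by rewrite graded_lieUU (scaling_morph a0 wpsi epsi) !scalerA gc.
Qed.

End Graded.

(** * Characters from multiplicativity on distinct elements *)

(** [h 4] can be computed as [h 3 * h 1 = h 2 * h 1 ^ 2]. On the other hand
    [h 4 * h (-2) = h 2] and [h 2 * h (-2) = 1], so that [h 4 = h 2 ^ 2] too, and the
    invertible factor [h 2] cancels. *)
Lemma int_mul_double (F : fieldType) (h : int -> F) : h 0 = 1 ->
  (forall i j, i != j -> h (i + j) = h i * h j) -> h 2 = h 1 * h 1.
Proof.
move=> h0 hD.
have h2 : h 2 * h (-2) = 1 by rewrite -hD.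
have h3 : h 3 = h 2 * h 1 by rewrite -hD.
have h4 : h 4 = h 3 * h 1 by rewrite -hD.
have h4' : h 4 * h (-2) = h 2 by rewrite -hD.
have n2 : h 2 != 0 by apply/eqP => h20; move/eqP: h2; rewrite h20 mul0r eq_sym oner_eq0.
apply: (mulfI n2); rewrite mulrA -h3 -h4 -{2}h4' mulrCA h2 mulr1.
by [].
Qed.

Lemma morphMz (K V : zmodType) (w : K -> V) (k : K) (i : int) :
  {morph w : x y / x + y} -> w (k *~ i) = w k *~ i.
Proof.
move=> wD; have w0 : w 0 = 0 by apply: (@addrI _ (w 0)); rewrite -wD !addr0.
have wN x : w (- x) = - w x by apply: (@addrI _ (w x)); rewrite -wD !addrN.
elim/int_rect: i => [|n IHn|n IHn]; first by rewrite !mulr0z.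
  by rewrite -addn1 PoszD !mulrzDr wD IHn.
by rewrite -addn1 PoszD opprD !mulrzDr wD IHn !mulrNz wN.
Qed.

(** The weight [w] ensures that the multiples of [k] are distinct. *)
Lemma morph_double (F : numFieldType) (K : zmodType) (w f : K -> F) (k : K) :
  {morph w : x y / x + y} -> w k != 0 -> f 0 = 1 ->
  (forall i j : int, k *~ i != k *~ j ->
     f (k *~ i + k *~ j) = f (k *~ i) * f (k *~ j)) ->
  f (k + k) = f k * f k.
Proof.
move=> wD wk f0 fD; have := @int_mul_double F (fun i => f (k *~ i)).
rewrite -[k + k]/(k *~ 2) mulr0z mulr1z; apply => // i j nij.
rewrite mulrzDr fD //; apply: contra nij => /eqP/(congr1 w).
rewrite !morphMz // -[w k *~ i]mulrzl -[w k *~ j]mulrzl => /(mulIf wk)/eqP.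
by rewrite eqr_int.
Qed.

(** * Generalized Witt algebras *)

Section WittAutomorphisms.
Variables (F : numFieldType) (Gamma : zmodClosed F).

Local Notation K := (subgroup Gamma).

Definition witt_weight (k : K) : F := val k.
(** A purely even algebra: the parity takes values in the trivial group. *)
Definition witt_parity (k : K) : 'I_1 := 0.
Definition witt_coef (k l : K) : F := val k - val l.
Local Notation wt := witt_weight.
Local Notation par := witt_parity.
Local Notation cf := witt_coef.

Lemma witt_weightD : {morph wt : k l / k + l}.
Proof. by move=> k l; rewrite /wt subgroupD. Qed.

Lemma witt_parityD : {morph par : k l / k + l}.
Proof. by move=> k l; rewrite [RHS]ord1. Qed.

Lemma witt_weight_inj k l : wt k = wt l -> par k = par l -> k = l.
Proof. by move/val_inj. Qed.

Lemma witt_coef0 k : cf 0 k = - wt k.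
Proof. by rewrite /cf raddf0 sub0r. Qed.

Lemma witt_coef_eq0 k l :
  par k = 0 -> cf k l = 0 -> wt l = wt k \/ wt l + wt l = wt k.
Proof. by move=> _ /eqP; rewrite subr_eq0 => /eqP; left. Qed.

Lemma witt_lieE x y : @witt_lie F Gamma x y = graded_lie cf x y.
Proof.
move: x y; apply: bilinear_eq => [y|x|y|x|k l].
- by move=> a u v; rewrite witt_lieDl.
- by move=> a u v; rewrite witt_lieDr.
- by move=> a u v; rewrite graded_lieDl.
- by move=> a u v; rewrite graded_lieDr.
by rewrite witt_lieU graded_lieUU.
Qed.

Lemma lieAut_Witt_graded phi :
  lieAut (Witt Gamma) phi <-> graded_auto par cf phi.
Proof.
have lieE (x y : Witt Gamma) : lie x y = graded_lie cf x y by exact: witt_lieE.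
split=> [[phiL phiB phiM]|[phiL phiB _ phiM]]; split.
- exact: phiL.
- exact: phiB.
- by move=> i x _ k _; rewrite (ord1 i).
- by move=> x y; rewrite -!lieE; exact: phiM.
- exact: phiL.
- exact: phiB.
by move=> x y; rewrite !lieE; exact: phiM.
Qed.

Lemma witt_phiU a f (k l : K) : val k = a * val l -> a != 0 ->
  witt_phi a f << k >> = (a * f k) *: << l >>.
Proof.
by move=> kl a0; rewrite -LE witt_phiL kl [a * val l]mulrC (mulfK a0) LE.
Qed.

Theorem lieAut_Witt : (exists P : pred F, total_cone P) ->
  lieAut (Witt Gamma) =
  [set phi : Witt Gamma -> Witt Gamma |
    exists (a : F) (f : subgroup Gamma -> F),
      [/\ dual F (subgroup Gamma) f, a != 0,
          [set a * m | m in [set` Gamma]] = [set` Gamma] &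
          phi = witt_phi a f]].
Proof.
move=> coneF; apply/seteqP; split=> phi.
  move/lieAut_Witt_graded => autphi.
  have [a [g [psi [[a0 g0 gN0 phiE] [wpsi _ psi_onto gc]]]]] :=
    auto_monomial witt_weightD witt_parityD witt_weight_inj
      witt_coef0 witt_coef_eq0 autphi coneF.
  pose f k := g k / a.
  have cfpsi k l : cf k l = a * cf (psi k) (psi l).
    by rewrite /cf mulrBr -!wpsi.
  have fD k l : k != l -> f (k + l) = f k * f l.
    move=> nkl; have ncf : cf k l != 0 by rewrite subr_eq0 (inj_eq val_inj).
    by apply: (mulfI ncf); rewrite /f [LHS]mulrA gc (cfpsi k l); field.
  have f0 : f 0 = 1 by rewrite /f g0 divff.
  exists a, f; split=> //.
  - split=> [k|k l]; first by rewrite mulf_neq0 ?invr_eq0.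
    have [<-|/fD //] := eqVneq k l.
    (* The bracket of a basis vector with itself is zero and says nothing. *)
    have [->|k0] := eqVneq k 0; first by rewrite addr0 f0 mulr1.
    have wk0 : wt k != 0 by apply: contra_neq k0 => wk; apply: val_inj; rewrite raddf0.
    by apply: (morph_double witt_weightD wk0 f0) => i j; apply: fD.
  - apply/seteqP; split=> [_ [m mG <-]|m mG] /=.
      have [k kE] := psi_onto (Sub m mG).
      by rewrite (_ : m = wt (psi k)) -?wpsi ?kE ?/wt ?SubK //; exact: valP.
    by exists (wt (psi (Sub m mG))); [exact: valP | rewrite -wpsi /wt SubK].
  have [phiL _ _ _] := autphi.
  apply/funext => x; apply: (lin_ext_eq phiL (witt_phi_linear a f)) => k _.
  by rewrite phiE (witt_phiU f (wpsi k) a0) [a * _]mulrC divfK.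
case=> a [f [[fN0 fD] a0 aG ->]]; apply/lieAut_Witt_graded.
have /choice[psi wpsi] : forall k, exists l, wt k = a * wt l.
  move=> k; have : [set a * m | m in [set` Gamma]] (wt k) by rewrite aG; exact: valP.
  by case=> m mG mk; exists (Sub m mG); rewrite /wt SubK.
have psi_onto l : exists k, psi k = l.
  have alG : a * wt l \in Gamma.
    have : [set` Gamma] (a * wt l) by rewrite -aG; exists (wt l) => //; exact: valP.
    by [].
  exists (Sub (a * wt l) alG); apply: val_inj; apply: (mulfI a0).
  by rewrite -/(wt _) -wpsi /wt SubK.
apply: (monomial_auto witt_weightD witt_parityD witt_weight_inj
  (g := fun k => a * f k) (witt_phi_linear a f) a0 _ _ wpsi _ psi_onto).
- by move=> k; apply: mulf_neq0 (fN0 k).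
- by move=> k; apply: witt_phiU.
- by [].
move=> k l; have -> : cf k l = a * cf (psi k) (psi l) by rewrite /cf mulrBr -!wpsi.
by rewrite fD; ring.
Qed.

End WittAutomorphisms.

(** * Super Witt algebras *)

Section SuperWittAutomorphisms.
Variables (F : numFieldType) (Gamma : zmodClosed (F * 'Z_2)%type).

Local Notation K := (subgroup Gamma).

Definition switt_weight (k : K) : F := (val k).1.
Definition switt_parity (k : K) : 'Z_2 := (val k).2.
Definition switt_cf (k l : K) : F := switt_coef (val k) (val l).
(** The factor of a basis vector under [switt_phi a f], apart from [f]. *)
Definition switt_scale (a : F) (k : K) : F :=
  if switt_parity k == 0 then a ^+ 2 else a.
Local Notation wt := switt_weight.
Local Notation par := switt_parity.
Local Notation cf := switt_cf.
Local Notation scale := switt_scale.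

Lemma Z2_add11 : 1 + 1 = 0 :> 'Z_2.
Proof. exact: val_inj. Qed.

Lemma switt_weightD : {morph wt : k l / k + l}.
Proof. by move=> k l; rewrite /wt subgroupD. Qed.

Lemma switt_parityD : {morph par : k l / k + l}.
Proof. by move=> k l; rewrite /par subgroupD. Qed.

Lemma switt_weight_inj k l : wt k = wt l -> par k = par l -> k = l.
Proof.
by move=> w_kl p_kl; apply: val_inj; apply/eqP; apply/andP; split; apply/eqP.
Qed.

Lemma switt_cfE k l : cf k l =
  if par k == 0 then (if par l == 0 then wt k - wt l else wt k / 2 - wt l)
  else (if par l == 0 then wt k - wt l / 2 else 2).
Proof. by rewrite /cf /switt_coef /par /wt; case: eqP; case: eqP. Qed.

Lemma switt_weight0 : wt 0 = 0.
Proof. by apply: (@addrI _ (wt 0)); rewrite -switt_weightD !addr0. Qed.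

Lemma switt_parity0 : par 0 = 0.
Proof. by apply: (@addrI _ (par 0)); rewrite -switt_parityD !addr0. Qed.

Lemma switt_cf0 k : cf 0 k = - wt k.
Proof.
by rewrite switt_cfE switt_parity0 switt_weight0 eqxx mul0r !sub0r; case: ifP.
Qed.

Lemma switt_cf_eq0 k l :
  par k = 0 -> cf k l = 0 -> wt l = wt k \/ wt l + wt l = wt k.
Proof.
rewrite switt_cfE => ->; rewrite eqxx; case: ifP => _ /eqP; rewrite subr_eq0.
  by move/eqP; left.
by move/eqP=> <-; right; rewrite -splitr.
Qed.

(** The cocycle identity for the trivial character. *)
Lemma switt_cf_scale (a : F) (psi : K -> K) k l : a != 0 ->
  (forall k, wt k = a ^+ 2 * wt (psi k)) -> (forall k, par (psi k) = par k) ->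
  scale a k * scale a l * cf (psi k) (psi l) = scale a (k + l) * cf k l.
Proof.
move=> a0 wpsi ppsi; rewrite !switt_cfE /scale !ppsi switt_parityD.
rewrite (wpsi k) (wpsi l).
by case: (Z2P (par k)) (Z2P (par l)) => -> [] ->;
  rewrite ?Z2_add11 ?addr0 ?add0r ?eqxx /=; field.
Qed.

Lemma switt_lieE x y : @switt_lie F Gamma x y = graded_lie cf x y.
Proof.
move: x y; apply: bilinear_eq => [y|x|y|x|k l].
- by move=> a u v; rewrite switt_lieDl.
- by move=> a u v; rewrite switt_lieDr.
- by move=> a u v; rewrite graded_lieDl.
- by move=> a u v; rewrite graded_lieDr.
by rewrite switt_lieU graded_lieUU.
Qed.

Lemma slieAut_sWitt_graded phi :
  slieAut (sWitt Gamma) phi <-> graded_auto par cf phi.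
Proof.
have slieE (x y : sWitt Gamma) : slie x y = graded_lie cf x y.
  exact: switt_lieE.
split=> [[phiL phiB phiP phiM]|[phiL phiB phiP phiM]]; split.
- exact: phiL.
- exact: phiB.
- exact: phiP.
- by move=> x y; rewrite -!slieE; exact: phiM.
- exact: phiL.
- exact: phiB.
- exact: phiP.
by move=> x y; rewrite !slieE; exact: phiM.
Qed.

Lemma switt_phiU a f (k l : K) : wt k = a ^+ 2 * wt l -> par l = par k ->
  a != 0 -> switt_phi a f << k >> = (scale a k * f k) *: << l >>.
Proof.
rewrite /switt_phi lin_extU /scale /par => kl pl a0.
have wl : (val k).1 / a ^+ 2 = wt l.
  by rewrite -/(wt k) kl mulrC mulKf // expf_neq0.
rewrite wl -basis_at_val /sL /sG.
by have [pk|pk] := Z2P (val k).2; rewrite pk /= -pk -pl /wt -surjective_pairing.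
Qed.

(** Two odd vectors always have a nonzero bracket. The even pairs are those of
    a Witt algebra. The remaining pairs without information are [(l + l, l)]
    with [l] odd: there [f (l + l + l) * f l] is a value at a sum of two odd
    elements, and regrouping that sum as [(l + l) + (l + l)] determines it. *)
Lemma switt_morph (f : K -> F) : f 0 = 1 -> (forall k, f k != 0) ->
  (forall k l, cf k l != 0 -> f (k + l) = f k * f l) ->
  {morph f : k l / k + l >-> k * l}.
Proof.
move=> f0 fN0 fD.
have odd_odd k l : par k = 1 -> par l = 1 -> f (k + l) = f k * f l.
  by move=> k1 l1; rewrite fD // switt_cfE k1 l1 /= pnatr_eq0.
have even_even k l : par k = 0 -> par l = 0 -> f (k + l) = f k * f l.
  have distinct i j : par i = 0 -> par j = 0 -> i != j -> f (i + j) = f i * f j.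
    move=> i0 j0 nij; rewrite fD // switt_cfE i0 j0 eqxx subr_eq0.
    by apply: contra_neq nij => wij; apply: switt_weight_inj; rewrite ?i0.
  move=> k0 l0; have [<-|] := eqVneq k l; last exact: distinct.
  have [->|nk] := eqVneq k 0; first by rewrite addr0 f0 mulr1.
  have wk : wt k != 0.
    apply: contra_neq nk => wk.
    by apply: switt_weight_inj; rewrite ?switt_weight0 ?switt_parity0.
  have even_mul i : par (k *~ i) = 0.
    by rewrite (morphMz _ _ switt_parityD) k0 mul0rz.
  by apply: (morph_double switt_weightD wk f0) => i j; apply: distinct.
have even_odd k l : par k = 0 -> par l = 1 -> f (k + l) = f k * f l.
  move=> k0 l1; have [cf_kl|] := eqVneq (cf k l) 0; last exact: fD.
  have kll : k = l + l.
    apply: switt_weight_inj; rewrite ?switt_weightD ?switt_parityD.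
      move: cf_kl; rewrite switt_cfE k0 l1 /= => /eqP.
      by rewrite subr_eq0 => /eqP <-; rewrite -splitr.
    by rewrite k0 l1 Z2_add11.
  have kl1 : par (k + l) = 1 by rewrite switt_parityD k0 l1 add0r.
  apply: (mulIf (fN0 l)); rewrite -(odd_odd (k + l) l) // -addrA -kll even_even //.
  by rewrite -mulrA -(odd_odd l l) // -kll.
move=> k l; case: (Z2P (par k)) (Z2P (par l)) => pk [] pl.
- exact: even_even.
- exact: even_odd.
- by rewrite addrC mulrC even_odd.
exact: odd_odd.
Qed.

(** [S] is a normalization of square roots. Replacing [a] by [- a] changes
    [switt_phi a f] only by a sign on the odd part, which is a character, so
    any [S] that selects at least one root of each number gives all
    automorphisms. *)
Theorem slieAut_sWitt (S : F -> Prop) : (exists P : pred F, total_cone P) ->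
  (forall z, exists2 a, a ^+ 2 = z & S a) ->
  slieAut (sWitt Gamma) =
  [set phi : sWitt Gamma -> sWitt Gamma |
    exists (a : F) (f : subgroup Gamma -> F),
      [/\ dual F (subgroup Gamma) f, a != 0 /\ S a,
          [set a ^+ 2 * m | m in fiber Gamma 0] = fiber Gamma 0,
          [set a ^+ 2 * r | r in fiber Gamma 1] = fiber Gamma 1 &
          phi = switt_phi a f]].
Proof.
move=> coneF sqrtS; apply/seteqP; split=> phi.
  move/slieAut_sWitt_graded => autphi.
  have [b [g [psi [[b0 g0 gN0 phiE] [wpsi ppsi psi_onto gc]]]]] :=
    auto_monomial switt_weightD switt_parityD switt_weight_inj
      switt_cf0 switt_cf_eq0 autphi coneF.
  have [a ab Sa] := sqrtS b; rewrite -{b}ab in b0 g0 wpsi.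
  have a0 : a != 0 by rewrite expf_eq0 in b0.
  have s0 k : scale a k != 0 by rewrite /scale; case: ifP.
  pose f k := g k / scale a k.
  have fN0 k : f k != 0 by rewrite mulf_neq0 ?invr_eq0.
  have fD k l : cf k l != 0 -> f (k + l) = f k * f l.
    move=> ncf; apply: (mulfI ncf); rewrite /f [LHS]mulrA gc.
    apply: (mulfI (s0 (k + l))); rewrite [RHS]mulrA.
    rewrite -(switt_cf_scale k l a0 wpsi ppsi).
    by field; rewrite !s0.
  have f0 : f 0 = 1 by rewrite /f g0 /scale switt_parity0 eqxx divff.
  have fiberE i : [set a ^+ 2 * m | m in fiber Gamma i] = fiber Gamma i.
    apply/seteqP; split=> [_ [m mG <-]|m mG] /=.
      have [k kE] := psi_onto (Sub (m, i) mG).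
      have -> : a ^+ 2 * m = wt k by rewrite wpsi kE /wt SubK.
      have <- : par k = i by rewrite -ppsi kE /par SubK.
      by rewrite /fiber /= -surjective_pairing; exact: valP.
    pose k : K := Sub (m, i) mG; have wk : wt k = m by rewrite /wt SubK.
    have pk : par k = i by rewrite /par SubK.
    exists (wt (psi k)); last by rewrite -wpsi.
    by rewrite /fiber /= -pk -ppsi -surjective_pairing; exact: valP.
  exists a, f; split=> //.
    by split=> //; apply: switt_morph.
  have [phiL _ _ _] := autphi.
  apply/funext => x; apply: (lin_ext_eq phiL (switt_phi_linear a f)) => k _.
  by rewrite phiE (switt_phiU f (wpsi k) (ppsi k) a0) [scale _ _ * _]mulrC divfK.
case=> a [f [[fN0 fD] [a0 _] G0 G1 ->]]; apply/slieAut_sWitt_graded.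
have fiberE i : [set a ^+ 2 * m | m in fiber Gamma i] = fiber Gamma i.
  by case: (Z2P i) => ->.
have aa0 : a ^+ 2 != 0 by rewrite expf_neq0.
have /choice[psi psiP] : forall k, exists l, wt k = a ^+ 2 * wt l /\ par l = par k.
  move=> k; have : fiber Gamma (par k) (wt k).
    by rewrite /fiber /= -surjective_pairing; exact: valP.
  rewrite -fiberE => -[m mG mk]; exists (Sub (m, par k) mG).
  by rewrite /wt /par SubK.
have wpsi k : wt k = a ^+ 2 * wt (psi k) by case: (psiP k).
have ppsi k : par (psi k) = par k by case: (psiP k).
have psi_onto l : exists k, psi k = l.
  have alG : (a ^+ 2 * wt l, par l) \in Gamma.
    have : fiber Gamma (par l) (a ^+ 2 * wt l).
      rewrite -fiberE; exists (wt l) => //.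
      by rewrite /fiber /= -surjective_pairing; exact: valP.
    by [].
  exists (Sub (a ^+ 2 * wt l, par l) alG); apply: switt_weight_inj.
    by apply: (mulfI aa0); rewrite -wpsi /wt SubK.
  by rewrite ppsi /par SubK.
apply: (monomial_auto switt_weightD switt_parityD switt_weight_inj
  (g := fun k => scale a k * f k) (switt_phi_linear a f) aa0 _ _ wpsi ppsi psi_onto).
- by move=> k; apply: mulf_neq0 (fN0 k); rewrite /scale; case: ifP.
- by move=> k; apply: switt_phiU.
move=> k l; rewrite fD mulrACA [RHS]mulrAC (switt_cf_scale k l a0 wpsi ppsi).
by ring.
Qed.

End SuperWittAutomorphisms.

(** * The complex case *)

Section ComplexCone.
Variable R : realType.

(** Positivity for the lexicographic order on real and imaginary parts. *)
Definition lex_pos (z : R[i]) :=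
  (0 < complex.Re z) || (complex.Re z == 0) && (0 < complex.Im z).

Lemma lex_pos_cone : @total_cone R[i] lex_pos.
Proof.
split=> [[x1 x2] [y1 y2]||[x1 x2]]; rewrite /lex_pos /=.
- move=> /orP[h1|/andP[/eqP h1 h2]] /orP[h3|/andP[/eqP h3 h4]]; apply/orP.
  + by left; lra.
  + by left; lra.
  + by left; lra.
  by right; apply/andP; split; [apply/eqP; lra | lra].
- by rewrite ltxx eqxx.
rewrite eq_complex /= negb_and oppr_gt0 oppr_eq0.
by case: (ltgtP x1 0) => //= _; rewrite oppr_gt0; case: ltgtP.
Qed.

Lemma sqrt_Re_ge0 (z : R[i]) : exists2 a : R[i], a ^+ 2 = z & 0 <= complex.Re a.
Proof.
have [Re0|/ltW Re0] := leP 0 (complex.Re (sqrtC z)).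
  by exists (sqrtC z); rewrite ?sqrtCK.
exists (- sqrtC z); first by rewrite sqrrN sqrtCK.
by case: (sqrtC z) Re0 => u v /=; rewrite oppr_ge0.
Qed.

End ComplexCone.

Theorem theorem3p2 (R : realType) :
  (forall Gamma : zmodClosed R[i], 1 \in Gamma ->
     lieAut (Witt Gamma) =
     [set phi : Witt Gamma -> Witt Gamma |
       exists (a : R[i]) (f : subgroup Gamma -> R[i]),
         [/\ dual R[i] (subgroup Gamma) f,
             a != 0,
             [set a * m | m in [set` Gamma]] = [set` Gamma] &
             phi = witt_phi a f]])
  /\
  (forall Gamma : zmodClosed (R[i] * 'Z_2)%type,
     slieAut (sWitt Gamma) =
     [set phi : sWitt Gamma -> sWitt Gamma |
       exists (a : R[i]) (f : subgroup Gamma -> R[i]),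
         [/\ dual R[i] (subgroup Gamma) f,
             a != 0 /\ 0 <= complex.Re a,
             [set a ^+ 2 * m | m in fiber Gamma 0] = fiber Gamma 0,
             [set a ^+ 2 * r | r in fiber Gamma 1] = fiber Gamma 1 &
             phi = switt_phi a f]]).
Proof.
have coneC : exists P : pred R[i], total_cone P.
  by exists (@lex_pos R); apply: lex_pos_cone.
split=> Gamma; first by move=> _; apply: lieAut_Witt.
exact: (@slieAut_sWitt _ Gamma (fun a => 0 <= complex.Re a) coneC (@sqrt_Re_ge0 R)).
Qed.
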